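(* Let $\gamma \in \mathbb{R}$ with $\gamma \neq 0$ satisfy $$\left\lvert \gamma - \frac{r}{s}\right\rvert < \exp(-s^{12}) \quad \text{for infinitely many pairs } (r,s) \in \mathbb{Z} \times \mathbb{N}$$ (the pairs $(r,s)$ are not required to be coprime). For $\psi: \mathbb{N} \to [0,\infty)$ write $$W'(\psi,\gamma) := \left\{\alpha \in [0,1): \left\lvert \alpha - \frac{a + \gamma}{q}\right\rvert \leq \frac{\psi(q)}{q} \ \text{ for infinitely many } (a,q) \in \mathbb{Z} \times \mathbb{N} \text{ with } \gcd(a,q) = 1\right\}.$$ Then there exists a function $\psi: \mathbb{N} \to [0,\infty)$ with $$\sum_{q \in \mathbb{N}} \frac{\psi(q)\varphi(q)}{q} = \infty, \quad \text{but} \quad \lambda(W'(\psi,\gamma)) = 0.$$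
   Context: $\mathbb{N}$ denotes the positive integers, $\varphi$ denotes the Euler totient function and $\lambda$ denotes the Lebesgue measure on $\mathbb{R}$. The fractions $r/s$ in the hypothesis on $\gamma$ need not be in lowest terms, and distinct pairs $(r,s)$ representing the same rational count as different pairs; in particular every nonzero rational $\gamma$ satisfies the hypothesis. *)

(* Defs.v *)
From HB Require Import structures.
From mathcomp Require Import all_boot all_order all_algebra.
From mathcomp Require Import all_classical all_reals all_analysis.

Set Implicit Arguments.
Unset Strict Implicit.
Unset Printing Implicit Defensive.

Import Order.TTheory GRing.Theory Num.Theory.
Import numFieldNormedType.Exports.

Local Open Scope classical_set_scope.
Local Open Scope ring_scope.

(* The positive integers are rendered as the q : nat with 0 < q; the value of
   a function psi : nat -> R at 0 is never used. *)

(* The pairs (r, s) are not reduced: distinct pairs representing the same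
   rational number are distinct elements of the set. *)
Definition exp12_approximable (R : realType) (gamma : R) : Prop :=
  infinite_set [set rs : int * nat | (0 < rs.2)%N /\
    `|gamma - rs.1%:~R / rs.2%:R| < expR (- rs.2%:R ^+ 12)].

Definition W' (R : realType) (psi : nat -> R) (gamma : R) : set R :=
  [set alpha : R | 0 <= alpha < 1 /\
    infinite_set [set aq : int * nat |
      [/\ (0 < aq.2)%N, coprimez aq.1 aq.2%:Z &
        `|alpha - (aq.1%:~R + gamma) / aq.2%:R| <= psi aq.2 / aq.2%:R]]].

(* Main.v *)
Require Import Defs.
From HB Require Import structures.
From mathcomp Require Import all_boot all_order all_algebra.
From mathcomp Require Import all_classical all_reals all_analysis.
From mathcomp Require Import zify ring lra.

Set Implicit Arguments.
Unset Strict Implicit.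
Unset Printing Implicit Defensive.

Import Order.TTheory GRing.Theory Num.Theory.
Import numFieldNormedType.Exports.

Local Open Scope ring_scope.

(** The idea.  Shifting by gamma breaks the independence on which the
    homogeneous theory rests: coprimality of a and q says nothing about common
    factors of a s + r and q s, so when gamma is very close to r/s the fractions
    (a + r/s)/q with different denominators q collide far more often than their
    number suggests.

    One block.  Let N be a product of distinct primes not dividing r s, let q
    run over divisors of N, put e = N/q and psi(q) = q/N = 1/e.  The sum of
    psi(q) phi(q)/q over all divisors q is (1/N) times the sum of phi(q), i.e. 1.
    The centres are c/(N s) with c = (a s + r) e, and all the intervals have the
    same radius 1/N, so the measure of their union is at most a constant times
    (number of residues c mod N s that occur)/N.  Let k(c) be the number of primes
    of N dividing c.  For uniform c mod N s, k(c) is close to a Poisson variable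
    with mean L, the sum of 1/p over p | N.  For the c which comes from a uniform
    pair (q, a) the mean is 2L: each prime p divides e with probability 1/p, and
    otherwise divides a s + r with probability about 1/p.  A threshold K strictly
    between L and 2L therefore works: the residues with k(c) >= K are few among
    all N s residues, and the pairs (q, a) with k(c) < K are few among all N
    pairs.  Both tails are exponential in L and the first must beat the factor
    s, so L has to be a large multiple of log s, which is why primes up to
    2^(s^11) are admitted.  The exponential moments [card_residues] make this
    precise, with Pi, the product of 1 + 1/p, in the role of exp L: the
    count is at most N (s Pi / 2^K + (6/5)^K F) where F^3 Pi <= 1.  If Pi is about
    (7/4)^K and about s^6, both terms are small compared with N: the first is about
    s (7/8)^K, which tends to 0, and (6/5)^3 = 1.728 < 7/4 takes care of the second
    ([exponent_choice]).

    Replacing r/s by gamma moves a centre by at most exp(-s^12)/q, which is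
    harmless as soon as e <= exp(s^12).  So q is restricted to those with at most
    s primes in e (then e <= 2^(s^12)), and this keeps at least a quarter of the
    total mass because the weight 2^(number of primes of e) has mean Pi, much less
    than 2^s ([near_full_mass]).

    The required primes exist because the product of 1 + 1/p over p <= 2^t is at
    least t/4 ([prod_primes_ge], from the divergence of the harmonic series), and
    discarding the primes dividing an integer n costs at most a factor n, here a
    quadratic polynomial in s ([primes_window]).

    Gluing.  Every prime of a block can be taken larger than a given bound, so
    blocks with measure at most 2^-(n+1) and mass at least 1/4 can be placed on
    successive disjoint ranges of q: the series diverges, and the limsup set is
    null by the Borel-Cantelli lemma. *)

(** * Sums over residues and over subsets *)

Lemma sum_crt2 (R : comPzRingType) (m n : nat) (f g : nat -> R) :
  coprime m n -> (0 < m)%N -> (0 < n)%N ->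
  \sum_(a < m * n) f (a %% m)%N * g (a %% n)%N
  = (\sum_(a < m) f a) * (\sum_(b < n) g b).
Proof.
move=> cmn m0 n0.
rewrite big_distrlr /= pair_bigA /=.
pose h (a : 'I_(m * n)) : 'I_m * 'I_n :=
  (Ordinal (ltn_pmod a m0), Ordinal (ltn_pmod a n0)).
rewrite (reindex h) //.
apply: onW_bij; apply: inj_card_bij; last by rewrite card_prod !card_ord.
move=> a b [] ham han; apply: val_inj => /=.
have : (a == b %[mod m * n])%N by rewrite chinese_remainder // ham han !eqxx.
by rewrite !modn_small // => /eqP.
Qed.

Lemma coprime_bigprod (I : eqType) (p : I -> nat) (d : nat) (s : seq I) :
  {in s, forall i, coprime d (p i)} -> coprime d (\prod_(i <- s) p i).
Proof.
by move=> h; rewrite big_seq; elim/big_ind: _ => [|x y hx hy|//];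
  rewrite ?coprimen1 ?coprimeMr ?hx ?hy.
Qed.

Lemma sum_crt_seq (R : comPzRingType) (I : eqType) (p : I -> nat)
    (g : I -> nat -> R) (s : seq I) :
  (forall i, 0 < p i)%N ->
  {in s &, forall i j, i != j -> coprime (p i) (p j)} -> uniq s ->
  \sum_(a < \prod_(i <- s) p i) \prod_(i <- s) g i (a %% p i)%N
  = \prod_(i <- s) \sum_(x < p i) g i x.
Proof.
move=> p0; elim: s => [|i s IH] cop /=.
  by rewrite !big_nil big_ord_recl big_ord0 big_nil addr0.
case/andP=> nis us; rewrite !big_cons -IH //; last first.
  by move=> j k js ks; apply: cop; rewrite inE ?js ?ks orbT.
have copi : coprime (p i) (\prod_(j <- s) p j).
  apply: coprime_bigprod => j js; apply: cop; rewrite ?inE ?eqxx ?js ?orbT //.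
  by apply: contraNneq nis => ->.
rewrite -(sum_crt2 (g i) (fun a => \prod_(j <- s) g j (a %% p j)%N)) //.
  apply: eq_bigr => a _; rewrite big_cons; congr (_ * _).
  apply: eq_big_seq => j js; rewrite modn_dvdm //.
  by rewrite (big_rem j) //= dvdn_mulr.
by apply: prodn_gt0.
Qed.

(** Residues modulo pairwise coprime moduli are independent: this turns every
    average over residues below into an Euler product. *)
Lemma sum_crt (R : comPzRingType) (I : finType) (p : I -> nat)
    (g : I -> nat -> R) (B : {set I}) :
  (forall i, 0 < p i)%N -> (forall i j, i != j -> coprime (p i) (p j)) ->
  \sum_(a < \prod_(i in B) p i) \prod_(i in B) g i (a %% p i)%N
  = \prod_(i in B) \sum_(x < p i) g i x.
Proof.
move=> p0 cop.
rewrite -(@big_enum _ _ _ I B p) -(@big_enum _ _ _ I B (fun i => \sum_(x < p i) _)) /=.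
rewrite -sum_crt_seq ?enum_uniq //; last by move=> i j _ _; apply: cop.
by apply: eq_bigr => a _; apply/esym/big_enum.
Qed.

(** The analogous factorisation for averages over the divisors of a squarefree
    number, encoded as sets of primes. *)
Lemma sum_subsets_prod (R : comPzSemiRingType) (I : finType) (F G : I -> R) :
  \sum_(B : {set I}) (\prod_(i in B) F i) * (\prod_(i in ~: B) G i)
  = \prod_i (F i + G i).
Proof.
rewrite bigA_distr /=; apply: eq_bigr => B _.
rewrite [RHS](bigID (fun i => i \in B)) /=; congr (_ * _).
  by apply: eq_bigr => i ->.
by apply: eq_big => i; rewrite ?inE // => /negbTE ->.
Qed.

Lemma totient_prod (I : finType) (p : I -> nat) (B : {set I}) :
  (forall i, prime (p i)) -> (forall i j, i != j -> coprime (p i) (p j)) ->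
  totient (\prod_(i in B) p i) = (\prod_(i in B) (p i).-1)%N.
Proof.
move=> pr cop; rewrite -(@big_enum _ _ _ I B p) -(@big_enum _ _ _ I B (fun i => (p i).-1)) /=.
elim: (enum B) (enum_uniq B) => [|i s IH] /=; first by rewrite !big_nil.
case/andP=> nis us; rewrite !big_cons totient_coprime.
  by rewrite IH // totient_prime.
by apply: coprime_bigprod => j js; apply: cop; apply: contraNneq nis => ->.
Qed.

Lemma dvdn_modl_self (p a : nat) : (p %| a %% p)%N = (p %| a)%N.
Proof. by rewrite /dvdn modn_mod. Qed.

(** * Divisors of a squarefree number and their residues *)

Section Weights.
Variables (R : realFieldType) (I : finType) (p : I -> nat).
Hypothesis pr : forall i, prime (p i).
Hypothesis p_inj : injective p.

Let p0 i : (0 < p i)%N. Proof. exact: prime_gt0. Qed.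

Lemma coprime_primes i j : i != j -> coprime (p i) (p j).
Proof.
move=> ij; rewrite prime_coprime // dvdn_prime2 //.
by apply: contra_neq ij => /p_inj.
Qed.
Let cop := coprime_primes.

Definition subprod (B : {set I}) : nat := \prod_(i in B) p i.
Definition fullprod := \prod_i p i.

Lemma subprod_gt0 B : (0 < subprod B)%N. Proof. exact: prodn_gt0. Qed.
Lemma fullprod_gt0 : (0 < fullprod)%N. Proof. exact: prodn_gt0. Qed.

Lemma subprodC B : (subprod B * subprod (~: B))%N = fullprod.
Proof.
rewrite /fullprod (bigID (fun i => i \in B)) /=; congr (_ * _)%N.
by apply: eq_bigl => i; rewrite !inE.
Qed.

Lemma dvdn_subprod B i : (p i %| subprod B)%N = (i \in B).
Proof.
apply/idP/idP => [|iB]; last by rewrite /subprod (bigD1 i) //= dvdn_mulr.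
apply: contraLR => iB; rewrite -prime_coprime // /subprod.
rewrite -(@big_enum _ _ _ I B p) /=; apply: coprime_bigprod => j.
by rewrite mem_enum => jB; apply: cop; apply: contraNneq iB => ->.
Qed.

Lemma subprod_inj : injective subprod.
Proof. by move=> B C h; apply/setP => i; rewrite -!dvdn_subprod h. Qed.

Lemma natr_pred i : (p i).-1%:R = (p i)%:R - 1 :> R.
Proof. by rewrite -subn1 natrB. Qed.

(** For z = 1 this is the classical sum of phi over the divisors; for z = 2 it
    gives an exponential moment of the number of primes of the cofactor. *)
Lemma sum_totient_weighted (z : R) :
  \sum_(B : {set I}) (totient (subprod B))%:R * z ^+ #|~: B|
  = \prod_i ((p i)%:R - 1 + z).
Proof.
rewrite -sum_subsets_prod; apply: eq_bigr => B _.
rewrite prodr_const totient_prod // natr_prod; congr (_ * _).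
by apply: eq_bigr => i _; rewrite natr_pred.
Qed.

Lemma sum_totient : \sum_(B : {set I}) (totient (subprod B))%:R = fullprod%:R :> R.
Proof.
rewrite /fullprod natr_prod; transitivity (\prod_i ((p i)%:R - 1 + 1 : R)).
  by rewrite -sum_totient_weighted; apply: eq_bigr => B _; rewrite expr1n mulr1.
by apply: eq_bigr => i _; rewrite subrK.
Qed.

(** The set of primes of q determines q, and the cofactor of q is the product
    over the complement; q = 1 is left out because it is not large. *)
Definition near_full (M : nat) : {set {set I}} :=
  [set B : {set I} | (0 < #|B|)%N && (#|~: B| <= M)%N].

Lemma in_near_full M B :
  (B \in near_full M) = (0 < #|B|)%N && (#|~: B| <= M)%N.
Proof. by rewrite inE. Qed.

(** By Markov's inequality for 2^(number of primes of the cofactor), the divisors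
    with more than M missing primes carry at most half of the total mass
    [fullprod]; the divisor 1 carries at most a quarter of it. *)
Lemma near_full_mass (M : nat) : (4 <= fullprod)%N ->
  2 * \prod_i ((p i)%:R + 1) <= 2 ^+ M * fullprod%:R :> R ->
  4^-1 * fullprod%:R <= \sum_(B in near_full M) (totient (subprod B))%:R :> R.
Proof.
move=> N4 hM.
have wgt : \sum_(B : {set I}) (totient (subprod B))%:R * 2 ^+ #|~: B|
    = \prod_i ((p i)%:R + 1) :> R.
  by rewrite sum_totient_weighted; apply: eq_bigr => i _; ring.
pose big := [set B : {set I} | (M < #|~: B|)%N].
have hbig : 2 * \sum_(B in big) (totient (subprod B))%:R <= fullprod%:R :> R.
  have s2 : 0 < 2 ^+ M :> R by rewrite exprn_gt0.
  rewrite -(ler_pM2l s2); apply: le_trans hM; rewrite -wgt.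
  rewrite mulrCA ler_pM2l // mulr_sumr.
  apply: (@le_trans _ _ (\sum_(B in big) (totient (subprod B))%:R * 2 ^+ #|~: B|)).
    apply: ler_sum => B; rewrite inE => hB; rewrite mulrC; apply: ler_wpM2l => //.
    by apply: ler_weXn2l; rewrite ?ler1n // ltnW.
  rewrite [leRHS](bigID (fun B => B \in big)) /= lerDl; apply: sumr_ge0 => B _.
  by rewrite mulr_ge0 ?exprn_ge0.
have N4' : 4 <= fullprod%:R :> R by rewrite ler_nat.
have total : fullprod%:R <= \sum_(B in near_full M) (totient (subprod B))%:R
    + \sum_(B in big) (totient (subprod B))%:R + 1 :> R.
  rewrite -sum_totient (bigID (fun B => B \in near_full M)) /= -addrA lerD2l.
  rewrite (bigID (fun B : {set I} => #|B| == 0)) /= addrC; apply: lerD.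
    rewrite [leLHS]big_mkcond [leRHS]big_mkcond; apply: ler_sum => B _ /=.
    rewrite !inE; case: ifPn => [/andP[h B0]|_]; last by case: ifP.
    by rewrite lt0n B0 /= -ltnNge in h; rewrite h.
  apply: (@le_trans _ _ (\sum_(B : {set I} | #|B| == 0) (totient (subprod B))%:R)).
    rewrite [leLHS]big_mkcond [leRHS]big_mkcond; apply: ler_sum => B _ /=.
    by case: (#|B| == 0); rewrite ?andbF //= andbT; case: ifP.
  rewrite (big_pred1 finset.set0) /subprod ?big_set0 // => B /=.
  by rewrite cards_eq0.
by lra.
Qed.

Definition pcount (c : int) : nat := #|[pred i | (p i %| c)%Z]|.

Lemma expr_pcount (z : R) c :
  z ^+ pcount c = \prod_i (if (p i %| c)%Z then z else 1).
Proof. by rewrite -big_mkcond prodr_const. Qed.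

Lemma pcount_mod_mul (s : nat) (c : int) :
  pcount (c %% (fullprod * s)%N%:Z)%Z = pcount c.
Proof.
apply: eq_card => i; rewrite !inE.
have pN : (p i %| (fullprod * s)%N%:Z)%Z.
  by rewrite dvdzE /=; apply: dvdn_mulr; rewrite /fullprod (bigD1 i) //= dvdn_mulr.
apply: esym; rewrite {1}(divz_eq c (fullprod * s)%N%:Z); apply: rpredDl.
exact: dvdz_mull.
Qed.

Lemma sum_if_dvdn i (z : R) :
  \sum_(x < p i) (if (p i %| x)%N then z else 1) = (p i)%:R - 1 + z.
Proof.
rewrite (bigD1 (Ordinal (p0 i))) //= dvdn0 addrC; congr (_ + _).
rewrite (eq_bigr (fun=> 1)); last first.
  move=> x; rewrite -val_eqE /= => x0.
  by rewrite gtnNdvd // lt0n.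
by rewrite sumr_const cardC1 card_ord natr_pred.
Qed.

(** The generating function of [pcount] on a full period is that of independent
    variables, the one at p being 1 with probability 1/p. *)
Lemma sum_pcount_period (z : R) :
  \sum_(c < fullprod) z ^+ pcount c = \prod_i ((p i)%:R - 1 + z).
Proof.
have := @sum_crt R I p (fun i c => if (p i %| c)%N then z else 1) [set: I] p0 cop.
have -> : \prod_(i in [set: I]) p i = fullprod by apply: eq_bigl => i; rewrite inE.
move=> h.
transitivity (\sum_(c < fullprod) \prod_(i in [set: I])
  (if (p i %| c %% p i)%N then z else 1)).
  apply: eq_bigr => c _; rewrite expr_pcount; apply: eq_big => i; rewrite ?inE //.
  by move=> _; rewrite dvdzE /= dvdn_modl_self.
by rewrite h; apply: eq_big => i; rewrite ?inE // => _; rewrite sum_if_dvdn.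
Qed.

Lemma sum_periods (f : nat -> R) (n s : nat) :
  (forall a, f (a + n)%N = f a) -> \sum_(c < n * s) f c = s%:R * \sum_(c < n) f c.
Proof.
move=> fn; elim: s => [|s IH]; first by rewrite muln0 big_ord0 mul0r.
have fs a : f (a + n * s)%N = f a.
  elim: (s) a => [|t IHt] a; first by rewrite muln0 addn0.
  by rewrite mulnS addnA IHt fn.
rewrite mulnSr big_split_ord /= IH -addn1 natrD mulrDl mul1r; congr (_ + _).
by apply: eq_bigr => i _; rewrite addnC fs.
Qed.

Lemma sum_pcount (z : R) (s : nat) :
  \sum_(c < fullprod * s) z ^+ pcount c = s%:R * \prod_i ((p i)%:R - 1 + z).
Proof.
rewrite -sum_pcount_period.
apply: (@sum_periods (fun c => z ^+ pcount c)) => a; congr (_ ^+ _).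
rewrite -[in LHS](@pcount_mod_mul 1) -[in RHS](@pcount_mod_mul 1) muln1.
by rewrite PoszD modzDr.
Qed.

Section Points.
Variables (r : int) (s : nat).
Hypotheses (p_s : forall i, ~~ (p i %| s)%N) (p_r : forall i, ~~ (p i %| r)%Z).

(** The centre (a + r/s)/q is this integer divided by [fullprod * s]. *)
Definition numer (B : {set I}) (a : int) : int :=
  (a * s%:Z + r) * (subprod (~: B))%:Z.

Lemma numer_root i : exists x : 'I_(p i), (p i %| x%:Z * s%:Z + r)%Z.
Proof.
have [u [v]] := Bezoutz s%:Z (p i)%:Z.
have -> : gcdz s%:Z (p i)%:Z = 1.
  rewrite /gcdz /=; congr Posz; apply/eqP.
  by rewrite -/(coprime _ _) coprime_sym prime_coprime.
move=> uv.
have pz : (p i)%:Z != 0 by rewrite eqz_nat -lt0n.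
have lt : (`|(- r * u) %% (p i)%:Z|%Z < p i)%N.
  by rewrite -ltz_nat gez0_abs ?modz_ge0 // ltz_mod.
exists (Ordinal lt); rewrite /= gez0_abs ?modz_ge0 //.
have -> : ((- r * u) %% (p i)%:Z)%Z =
  - r * u - ((- r * u) %/ (p i)%:Z)%Z * (p i)%:Z by [].
apply/dvdzP; exists (r * v - ((- r * u) %/ (p i)%:Z)%Z * s%:Z).
by rewrite -[X in _ + X]mulr1 -uv; ring.
Qed.

(** A residue x mod p is forbidden if it is 0, by coprimality, and gets the weight
    u if p divides x s + r.  The second case does occur, and for a nonzero x,
    because p divides neither s nor r. *)
Lemma sum_numer_local i (u : R) : u <= 1 ->
  \sum_(x < p i) (if (p i %| x)%N then 0
                  else if (p i %| x%:Z * s%:Z + r)%Z then u else 1)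
  <= (p i)%:R - 2 + u.
Proof.
move=> u1; have [x0 hx0] := numer_root i.
have x00 : ~~ (p i %| x0)%N.
  apply: contraNN (p_r i) => h.
  rewrite -(@rpredDl _ _ (x0%:Z * s%:Z)) //.
  by rewrite dvdzE abszM; apply: dvdn_mulr.
rewrite (bigD1 (Ordinal (p0 i))) //= dvdn0 add0r.
rewrite (bigD1 x0) /=; last by apply: contraNneq x00 => ->; rewrite dvdn0.
rewrite (negbTE x00) hx0 addrC lerD2r.
apply: (@le_trans _ _ (\sum_(x < p i | (x != Ordinal (p0 i)) && (x != x0)) 1)).
  by apply: ler_sum => x _; case: ifP => // _; case: ifP.
rewrite sumr_const.
have -> : #|(fun x => (x != Ordinal (p0 i)) && (x != x0))|
    = #|[set~ Ordinal (p0 i)] :\ x0|.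
  by apply: eq_card => x; rewrite !inE andbC.
have := cardsD1 x0 [set~ Ordinal (p0 i)].
rewrite !inE (_ : x0 != _ = true); last first.
  by apply: contraNneq x00 => ->; rewrite dvdn0.
rewrite cardsC1 card_ord => h.
have : (p i)%:R - 1 = (1 + #|[set~ Ordinal (p0 i)] :\ x0|)%:R :> R.
  by rewrite -h natr_pred.
by rewrite natrD; lra.
Qed.

(** Primes of the cofactor divide the numerator and contribute u; at the other
    primes the weight is that of [sum_numer_local]. *)
Lemma sum_numer B (u : R) : 0 <= u <= 1 ->
  \sum_(a < subprod B | coprime a (subprod B)) u ^+ pcount (numer B a)
  <= (\prod_(i in B) ((p i)%:R - 2 + u)) * (\prod_(i in ~: B) u).
Proof.
case/andP=> u0 u1.
pose g i x := if (p i %| x)%N then 0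
              else if (p i %| x%:Z * s%:Z + r)%Z then u else 1.
have g0 i x : 0 <= g i x by rewrite /g; case: ifP => // _; case: ifP.
have gper i x : g i (x %% p i)%N = g i x.
  rewrite /g dvdn_modl_self; case: ifP => // _; congr (if _ then _ else _).
  rewrite {2}(divn_eq x (p i)) PoszD mulrDl -addrA; apply: esym; apply: rpredDl.
  by rewrite PoszM mulrAC; apply: dvdz_mull.
apply: (@le_trans _ _ (\sum_(a < subprod B)
  (\prod_(i in B) g i (a %% p i)%N) * \prod_(i in ~: B) u)).
  rewrite [leRHS](bigID (fun a : 'I__ => coprime a (subprod B))) /=.
  rewrite -[leLHS]addr0; apply: lerD; last first.
    apply: sumr_ge0 => a _; apply: mulr_ge0; last by apply: prodr_ge0.
    by apply: prodr_ge0 => i _.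
  apply: ler_sum => a ca; rewrite expr_pcount (bigID (fun i => i \in B)) /=.
  apply: ler_pM; try by apply: prodr_ge0 => i _; case: ifP.
    apply: ler_prod => i iB; rewrite gper /g.
    have pq : (p i %| subprod B)%N by rewrite dvdn_subprod.
    have := coprime_dvdr pq ca; rewrite coprime_sym prime_coprime // => /negbTE ->.
    case: ifP => h1; case: ifP => h2; rewrite ?u0 ?ler01 ?lexx ?u1 //.
    by rewrite dvdz_mulr in h1.
  rewrite (eq_bigl (fun i => i \in ~: B)); last by move=> i; rewrite inE.
  apply: ler_prod => i iB.
  rewrite (_ : (p i %| _)%Z = true) ?u0 ?lexx //.
  by apply: dvdz_mull; rewrite dvdzE /= dvdn_subprod.
rewrite -mulr_suml sum_crt //; apply: ler_wpM2r; first exact: prodr_ge0.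
apply: ler_prod => i _; rewrite sumr_ge0 => [|x _]; last exact: g0.
exact: sum_numer_local.
Qed.

(** A prime weighs u when it is in the cofactor and p - 2 + u otherwise: both ways
    of dividing the numerator occur, which doubles the frequency seen in
    [sum_pcount]. *)
Lemma sum_numer_subsets (u : R) : 0 <= u <= 1 ->
  \sum_(B : {set I}) \sum_(a < subprod B | coprime a (subprod B)) u ^+ pcount (numer B a)
  <= \prod_i ((p i)%:R - 2 + 2 * u).
Proof.
move=> u01.
rewrite (eq_bigr (fun i => ((p i)%:R - 2 + u) + u)); last by move=> i _; ring.
by rewrite -sum_subsets_prod; apply: ler_sum => B _; apply: sum_numer.
Qed.

(** The centres modulo 1, in units of 1/([fullprod] s). *)
Definition residues : {set 'I_(fullprod * s)} :=
  [set c : 'I_(fullprod * s) | [exists B : {set I}, [exists a : 'I_(subprod B),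
     coprime a (subprod B) && ((numer B a %% (fullprod * s)%N%:Z)%Z == c%:Z)]]].

(** A residue with at least K primes is counted by 2^([pcount] c - K), summed over
    all residues.  One with fewer is counted by (6/5)^(K - [pcount] c), summed over
    all pairs (q, a) producing it. *)
Lemma card_residues (K : nat) :
  #|residues|%:R <= 2 ^- K * (s%:R * \prod_i ((p i)%:R + 1))
     + (6 / 5) ^+ K * \prod_i ((p i)%:R - 3^-1) :> R.
Proof.
pose v (c : int) : R := 2 ^- K * 2 ^+ pcount c.
pose w (c : int) : R := (6 / 5) ^+ K * (5 / 6) ^+ pcount c.
have v0 c : 0 <= v c by rewrite mulr_ge0 ?invr_ge0 ?exprn_ge0.
have w0 c : 0 <= w c by rewrite mulr_ge0 ?exprn_ge0 //; lra.
have vw1 c : 1 <= v c + w c.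
  have [Kc|cK] := leqP K (pcount c).
    rewrite -[leLHS]addr0 lerD // /v -(subnK Kc) exprD mulrCA.
    by rewrite mulVf ?expf_neq0 ?pnatr_eq0 // mulr1 exprn_ege1 // ler1n.
  rewrite -[leLHS]add0r lerD // /w -(subnK (ltnW cK)) exprD -mulrA -exprMn.
  have -> : 6 / 5 * (5 / 6) = 1 :> R by lra.
  by rewrite expr1n mulr1 exprn_ege1 //; lra.
rewrite -sum1_card natr_sum.
apply: (@le_trans _ _ (\sum_(c in residues) (v c + w c))); first exact: ler_sum.
rewrite big_split /= lerD //.
  apply: (@le_trans _ _ (\sum_(c < fullprod * s) v c)).
    rewrite [leRHS](bigID (fun c => c \in residues)) /= lerDl.
    by apply: sumr_ge0.
  rewrite -mulr_sumr sum_pcount.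
  rewrite (eq_bigr (fun i => (p i)%:R + 1)) // => i _; lra.
apply: (@le_trans _ _ (\sum_(B : {set I})
   \sum_(a < subprod B | coprime a (subprod B)) w (numer B a))); last first.
  rewrite (eq_bigr (fun B => (6 / 5) ^+ K * \sum_(a < subprod B | coprime a (subprod B))
    (5 / 6) ^+ pcount (numer B a))); last by move=> B _; rewrite mulr_sumr.
  rewrite -mulr_sumr; apply: ler_wpM2l; first by apply: exprn_ge0; lra.
  have -> : \prod_i ((p i)%:R - 3^-1) = \prod_i ((p i)%:R - 2 + 2 * (5 / 6)) :> R.
    by apply: eq_bigr => i _; lra.
  by apply: sum_numer_subsets; lra.
rewrite big_mkcond /=.
pose hit (B : {set I}) (c : 'I_(fullprod * s)) (a : 'I_(subprod B)) :=
  coprime a (subprod B) && ((numer B a %% (fullprod * s)%N%:Z)%Z == c%:Z).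
(* Each residue is produced by at least one pair, so summing w over the pairs
   dominates summing it over the residues. *)
apply: (@le_trans _ _ (\sum_(c < fullprod * s) \sum_(B : {set I})
   \sum_(a < subprod B | hit B c a) w c)).
  apply: ler_sum => c _; case: ifPn => [|_]; last first.
    by apply: sumr_ge0 => B _; apply: sumr_ge0.
  rewrite inE => /existsP [B] /existsP [a ha].
  rewrite (bigD1 B) //= (bigD1 a) //= -addrA lerDl addr_ge0 //.
    exact: sumr_ge0.
  by apply: sumr_ge0 => ? _; apply: sumr_ge0.
rewrite exchange_big /=; apply: ler_sum => B _.
under eq_bigr do rewrite big_mkcond /=.
rewrite exchange_big /= [leRHS]big_mkcond /=; apply: ler_sum => a _.
rewrite /hit; case: ifP => /= [_|_]; last by rewrite big1.
rewrite -big_mkcond /=.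
have w_mod c : w (c %% (fullprod * s)%N%:Z)%Z = w c by rewrite /w pcount_mod_mul.
case: (pickP (fun c : 'I_(fullprod * s) => (numer B a %% (fullprod * s)%N%:Z)%Z == c%:Z)).
  move=> c0 /eqP hc0; rewrite (big_pred1 c0); last first.
    by move=> c /=; rewrite hc0 eqz_nat -val_eqE eq_sym.
  by rewrite -hc0 w_mod.
by move=> h; rewrite big_pred0.
Qed.
End Points.
End Weights.

(** * Products over primes *)

Section Mertens.
Variable R : realFieldType.

(** A partial sum of the Euler product over the primes below k. *)
Definition smooth_harmonic (k x : nat) : R :=
  \sum_(m < x.+1 | (0 < m)%N && all (fun q => q < k)%N (primes m)) m%:R^-1.

Lemma smooth_harmonic_ge0 k x : 0 <= smooth_harmonic k x.
Proof. by apply: sumr_ge0 => m _; rewrite invr_ge0. Qed.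

(** The terms divisible by k are 1/k times terms of the same sum. *)
Lemma smooth_harmonic_prime k x : prime k ->
  smooth_harmonic k.+1 x <= smooth_harmonic k x + k%:R^-1 * smooth_harmonic k.+1 x.
Proof.
move=> pk; have k0 := prime_gt0 pk.
rewrite {1}/smooth_harmonic (bigID (fun m : 'I_x.+1 => k %| m)%N) /= addrC.
apply: lerD.
  rewrite /smooth_harmonic [leLHS]big_mkcond [leRHS]big_mkcond /=.
  apply: ler_sum => m _; case: ifP => [/andP [/andP[-> /allP sm] km]|_]; last by case: ifP; rewrite ?invr_ge0.
  rewrite ifT //; apply/allP => q qm; have := sm q qm; rewrite ltnS leq_eqVlt.
  case: eqP => // qk _; move: qm km; rewrite qk mem_primes => /and3P[_ _ ->] //.
rewrite mulr_sumr.
apply: (@le_trans _ _ (\sum_(m < x.+1) \sum_(j < x.+1 |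
   (0 < j)%N && all (fun q => q < k.+1)%N (primes j))
     if (m == k * j :> nat)%N then m%:R^-1 else 0)).
  rewrite [leLHS]big_mkcond; apply: ler_sum => m _.
  case: ifP => [/andP[/andP[m0 sm] km]|_]; last first.
    by apply: sumr_ge0 => j _; case: ifP; rewrite ?invr_ge0.
  have lt : (m %/ k < x.+1)%N by apply: leq_ltn_trans (leq_div _ _) (ltn_ord m).
  rewrite (bigD1 (Ordinal lt)) /=; last first.
    rewrite divn_gt0 // dvdn_leq //=; apply/allP => q.
    rewrite mem_primes => /and3P[qp q0 qd]; apply: (allP sm).
    by rewrite mem_primes qp m0 /=; apply: dvdn_trans qd (dvdn_div km).
  rewrite mulnC divnK // eqxx lerDl; by apply: sumr_ge0 => j _; case: ifP; rewrite ?invr_ge0.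
rewrite exchange_big /=; apply: ler_sum => j _.
rewrite -big_mkcond /= -invfM -natrM.
case: (pickP (fun m : 'I_x.+1 => m == k * j :> nat)%N) => [m /eqP hm|h].
  by rewrite (big_pred1 m) ?hm // => i; apply/eqP/eqP => [h|->//]; apply: val_inj; rewrite /= h.
by rewrite big_pred0 // invr_ge0.
Qed.

(** The finite form of Euler's product formula: expanding the product of
    1/(1 - 1/p) over p < k produces every 1/m with m having prime factors below k. *)
Lemma smooth_harmonic_le k x :
  (\prod_(p < k | prime p) (1 - p%:R^-1)) * smooth_harmonic k x <= 1.
Proof.
elim: k => [|k IH].
  rewrite big_ord0 mul1r /smooth_harmonic.
  case: x => [|x]; first by rewrite big_mkcond big_ord_recl big_ord0 /= addr0.
  rewrite (big_pred1 (Ordinal (isT : 1 < x.+2)%N)) ?invr1 // => m.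
  rewrite /= -val_eqE /=; case: (val m) => [|[|n]] //=.
  apply/negP => /allP /(_ (pdiv n.+2)); rewrite mem_primes pdiv_prime // pdiv_dvd.
  by move=> /(_ isT).
rewrite big_mkcond big_ord_recr /= -big_mkcond /=; case: ifP => pk; last first.
  rewrite mulr1; apply: le_trans IH; apply: ler_wpM2l.
    apply: prodr_ge0 => i pi; rewrite subr_ge0 invf_le1 ?ltr0n ?ler1n ?prime_gt0 //.
  rewrite /smooth_harmonic [leLHS]big_mkcond [leRHS]big_mkcond /=.
  apply: ler_sum => m _; case: ifP => [/andP[-> /allP sm]|_]; last by case: ifP; rewrite ?invr_ge0.
  rewrite ifT //; apply/allP => q qm; have := sm q qm; rewrite ltnS leq_eqVlt.
  by case: eqP => // qk; move: qm; rewrite qk mem_primes pk.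
apply: le_trans IH; rewrite -mulrA; apply: ler_wpM2l.
  apply: prodr_ge0 => i pi; rewrite subr_ge0 invf_le1 ?ltr0n ?ler1n ?prime_gt0 //.
by rewrite mulrBl mul1r lerBlDr; apply: smooth_harmonic_prime.
Qed.

(** The product over all integers from 2 to k + 1 telescopes to the left-hand
    side, and omitting factors below 1 only increases it.  It compares 1 + 1/p with
    1/(1 - 1/p) up to a factor 2. *)
Lemma prod_primes_inv_sqr k :
  2^-1 * (1 + k.+1%:R^-1) <= \prod_(p < k.+2 | prime p) (1 - p%:R^-1 ^+ 2) :> R.
Proof.
elim: k => [|k IH].
  by rewrite big_mkcond !big_ord_recl big_ord0 /=; lra.
rewrite big_mkcond big_ord_recr /= -big_mkcond /=.
have E : 2^-1 * (1 + k.+2%:R^-1) =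
    2^-1 * (1 + k.+1%:R^-1) * (1 - k.+2%:R^-1 ^+ 2) :> R.
  rewrite -(natr1 k.+1); have : (0 : R) < k.+1%:R by [].
  by move: (k.+1%:R) => x x0; field; apply/andP; split; apply: lt0r_neq0 => //; lra.
have k1 : 0 <= (k.+2%:R : R)^-1 <= 1.
  by apply/andP; split; [rewrite invr_ge0|rewrite invf_le1 ?ler1n ?ltr0n].
have h0 : (0 : R) <= 1 - k.+2%:R^-1 ^+ 2.
  by rewrite subr_ge0 expr_le1 //; case/andP: k1.
case: ifP => _; first by rewrite E; apply: ler_wpM2r.
rewrite mulr1; apply: le_trans IH; rewrite E.
by rewrite ler_piMr ?gerBl ?mulr_ge0 ?addr_ge0 ?exprn_ge0 ?invr_ge0.
Qed.

Lemma harmonic_pow2 t : t%:R / 2 <= \sum_(m < (2 ^ t).+1 | (0 < m)%N) m%:R^-1 :> R.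
Proof.
elim: t => [|t IH]; first by rewrite mul0r; apply: sumr_ge0 => m _; rewrite invr_ge0.
rewrite big_mkcond /= expnS mul2n -addnn -addSn big_split_ord /= -big_mkcond /=.
rewrite -natr1 mulrDl; apply: lerD => //.
apply: (@le_trans _ _ (\sum_(i < 2 ^ t) (2 * 2 ^ t)%:R^-1)).
  rewrite sumr_const card_ord -[_ *+ (2 ^ t)%N]mulr_natr natrM invfM mul1r -mulrA mulVf ?mulr1 //.
apply: ler_sum => i _ /=; rewrite lef_pV2 ?posrE ?ltr0n ?ler_nat //.
  by rewrite mul2n -addnn addSn; have := ltn_ord i; rewrite -(ltn_add2l (2 ^ t)).
by rewrite muln_gt0 expn_gt0.
Qed.

(** A weak form of Mertens' theorem, with the harmonic sum up to 2^t bounded below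
    by t/2. *)
Lemma prod_primes_ge t :
  t%:R / 4 <= \prod_(p < (2 ^ t).+1 | prime p) (1 + p%:R^-1) :> R.
Proof.
set x := (2 ^ t)%N; set P := leRHS.
have x0 : (0 < x)%N by rewrite expn_gt0.
have H := smooth_harmonic_le x.+1 x.
have D := prod_primes_inv_sqr x.-1; rewrite prednK // in D.
have P0 : 0 <= P by apply: prodr_ge0 => i _; rewrite addr_ge0 ?invr_ge0.
have hS : t%:R / 2 <= smooth_harmonic x.+1 x.
  apply: le_trans (harmonic_pow2 t) _.
  rewrite /smooth_harmonic le_eqVlt; apply/orP; left; apply/eqP.
  apply: eq_bigl => m; case: (posnP m) => //= m0.
  apply/esym/allP => q; rewrite mem_primes => /and3P [_ _ /dvdn_leq h].
  exact: leq_ltn_trans (h m0) (ltn_ord m).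
have E : \prod_(p < x.+1 | prime p) (1 - p%:R^-1 ^+ 2) =
   P * \prod_(p < x.+1 | prime p) (1 - p%:R^-1) :> R.
  by rewrite /P -big_split /=; apply: eq_bigr => i _; ring.
have S0 := smooth_harmonic_ge0 x.+1 x.
have h1 : 2^-1 <= \prod_(p < x.+1 | prime p) (1 - p%:R^-1 ^+ 2) :> R.
  apply: le_trans D; have : (0 : R) <= x%:R^-1 by rewrite invr_ge0.
  by lra.
have h2 : 2^-1 * smooth_harmonic x.+1 x <= P.
  apply: (@le_trans _ _ (P * 1)); last by rewrite mulr1.
  apply: le_trans (ler_wpM2l P0 H); rewrite mulrA -E; exact: ler_wpM2r.
by lra.
Qed.

Lemma prod_prime_divisors_dvd (n y : nat) :
  (\prod_(p < y | prime p && (p %| n)) p %| n)%N.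
Proof.
elim: y => [|y IH]; first by rewrite big_ord0 dvd1n.
rewrite big_mkcond big_ord_recr /= -big_mkcond /=.
case: ifP => [/andP[py yn]|_]; last by rewrite muln1.
rewrite Gauss_dvd ?IH // coprime_sym big_seq_cond.
elim/big_ind: _ => [|a b ha hb|i /andP[_ /andP[pi _]]]; first by rewrite coprimen1.
  by rewrite coprimeMr ha.
by rewrite prime_coprime // dvdn_prime2 // neq_ltn ltn_ord orbT.
Qed.

Lemma add1_invp_le p : prime p -> 1 + p%:R^-1 <= p%:R :> R.
Proof.
move=> pp; have p2 : (2 : R) <= p%:R by rewrite ler_nat prime_gt1.
have : p%:R^-1 <= 2^-1 :> R by rewrite lef_pV2 ?posrE //; lra.
by lra.
Qed.

(** Since 1 + 1/p <= p, the product over the primes dividing n is at most their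
    product, which divides n. *)
Lemma prod_primes_coprime_ge (n t : nat) : (0 < n)%N ->
  t%:R / 4 <= n%:R * \prod_(p < (2 ^ t).+1 | prime p && ~~ (p %| n)%N) (1 + p%:R^-1) :> R.
Proof.
move=> n0; apply: le_trans (prod_primes_ge t) _.
rewrite (bigID (fun p : 'I_(2 ^ t).+1 => p %| n)%N) /=; apply: ler_wpM2r.
  by apply: prodr_ge0 => i _; rewrite addr_ge0 ?invr_ge0.
apply: (@le_trans _ _ (\prod_(p < (2 ^ t).+1 | prime p && (p %| n)%N) p%:R)).
  by apply: ler_prod => i /andP[pi _]; rewrite addr_ge0 ?invr_ge0 //= add1_invp_le.
by rewrite -natr_prod ler_nat dvdn_leq // prod_prime_divisors_dvd.
Qed.

(** Each factor is at most 2, so the first prefix whose product reaches T does not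
    exceed 2 T. *)
Lemma prefix_window (F : nat -> R) (T : R) (s : seq nat) :
  (forall p, 1 <= F p <= 2) -> 1 <= T -> T <= \prod_(p <- s) F p ->
  exists j, T <= \prod_(p <- take j s) F p <= 2 * T.
Proof.
move=> F12 T1; elim/last_ind: s => [|s x IH].
  rewrite big_nil => h; exists 0%N; rewrite h /=; lra.
case: (lerP T (\prod_(p <- s) F p)) => [/IH [j hj] _|h].
  exists (minn j (size s)).
  by rewrite -cats1 takel_cat ?geq_minr // take_min take_size.
exists (size s).+1; rewrite -(size_rcons s x) take_size H /=.
rewrite -cats1 big_cat big_seq1 [2 * T]mulrC; apply: ler_pM => //.
- by apply: prodr_ge0 => i _; apply: le_trans ler01 _; case/andP: (F12 i).
- by apply: le_trans ler01 _; case/andP: (F12 x).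
- exact: ltW.
- by case/andP: (F12 x).
Qed.

Lemma primes_window (n t : nat) (T : R) : (0 < n)%N -> 1 <= T -> 4 * n%:R * T <= t%:R ->
  exists s : seq nat, [/\ uniq s,
    forall p, p \in s -> [/\ prime p, ~~ (p %| n)%N & (p <= 2 ^ t)%N] &
    T <= \prod_(p <- s) (1 + p%:R^-1) <= 2 * T].
Proof.
move=> n0 T1 hT.
pose s0 := [seq p <- iota 0 (2 ^ t).+1 | prime p && ~~ (p %| n)%N].
have F12 p : 1 <= 1 + (p%:R : R)^-1 <= 2.
  apply/andP; split; first by rewrite lerDl invr_ge0.
  case: p => [|p]; first by rewrite invr0; lra.
  have : p.+1%:R^-1 <= 1 :> R by rewrite invf_le1 ?ler1n ?ltr0n.
  by move: (_^-1) => z; lra.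
have := @prefix_window (fun p => 1 + p%:R^-1) T s0 F12 T1.
case.
  rewrite /s0 big_filter -[iota _ _]/(index_iota 0 (2 ^ t).+1) big_mkord.
  have := prod_primes_coprime_ge t n0; set P := \prod_(_ < _ | _) _ => hP.
  have n0' : (0 : R) < n%:R by rewrite ltr0n.
  rewrite -(ler_pM2l n0'); lra.
move=> j hj; exists (take j s0); split=> //.
  by rewrite take_uniq // filter_uniq // iota_uniq.
move=> p /mem_take; rewrite mem_filter mem_iota /= add0n ltnS => /andP[/andP[-> ->] ->].
by [].
Qed.
End Mertens.

(** * Choice of the modulus *)

Local Open Scope classical_set_scope.

Lemma finite_bounded_pairs (A : set (int * nat)) (b Q : nat) :
  (forall x, A x -> (`|x.1| < b)%N /\ (x.2 <= Q)%N) -> finite_set A.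
Proof.
move=> h; pose rl := [seq i%:Z - b%:Z | i <- iota 0 (b + b)].
apply: (@sub_finite_set _ _ [set` [seq (x, y) | x <- rl, y <- iota 0 Q.+1]]);
  last exact: finite_seq.
move=> [r s] /h /= [rb sQ].
suff: (r, s) \in [seq (x, y) | x <- rl, y <- iota 0 Q.+1] by [].
apply/allpairsP; exists (r, s); split => //; last by rewrite mem_iota add0n ltnS.
by apply/mapP; exists `|(r + b%:Z)%R|%N => /=; [rewrite mem_iota; lia | lia].
Qed.

Section Arith.
Variable R : realType.

Lemma expR_small (s : nat) : (0 < s)%N -> expR (- s%:R ^+ 12) <= s%:R^-1 :> R.
Proof.
move=> s0; rewrite expRN lef_pV2 ?posrE ?expR_gt0 ?ltr0n //.
apply: le_trans (expR_ge1Dx _).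
have s1 : 1 <= s%:R :> R by rewrite ler1n.
have : s%:R <= s%:R ^+ 12 :> R by apply: ler_eXnr.
by lra.
Qed.

(** For bounded s only finitely many r are possible.  Since gamma is not 0, also
    r is not 0 once s is large, so that only finitely many primes divide r. *)
Lemma approximable_large (gamma : R) (S : nat) : gamma <> 0 ->
  exp12_approximable gamma ->
  exists rs : int * nat, [/\ (S < rs.2)%N, rs.1 != 0,
    `|rs.1|%N%:R <= (`|gamma| + 1) * rs.2%:R &
    `|gamma - rs.1%:~R / rs.2%:R| < expR (- rs.2%:R ^+ 12)].
Proof.
move=> g0 ginf; have gp : 0 < `|gamma| by rewrite normr_gt0; apply/eqP.
pose S' := maxn S (Num.trunc (`|gamma|^-1)).+1.
apply: contrapT => hno; apply: ginf.
apply: (@finite_bounded_pairs _ (Num.trunc ((`|gamma| + 1) * S'%:R)).+1 S').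
move=> [r s] /= [s0 hrs].
have sR : 0 < s%:R :> R by rewrite ltr0n.
have s1 : 1 <= s%:R :> R by rewrite ler1n.
have hs := expR_small s0.
have hr : `|r|%N%:R <= (`|gamma| + 1) * s%:R :> R.
  rewrite -[X in X <= _](_ : `|r%:~R : R| = _); last first.
    by rewrite -intr_norm -abszE.
  have -> : r%:~R = (gamma - (gamma - r%:~R / s%:R)) * s%:R :> R.
    by field; exact: lt0r_neq0.
  rewrite normrM (gtr0_norm sR) ler_pM2r //.
  apply: le_trans (ler_normB _ _) _; rewrite lerD2l.
  apply: le_trans (ltW hrs) _; apply: le_trans hs _.
  by rewrite invf_le1.
have sS : (s <= S')%N.
  rewrite leqNgt; apply/negP => lt; apply: hno; exists (r, s); split=> //=.
    by apply: leq_ltn_trans lt; rewrite leq_maxl.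
  apply: contraTneq (hrs) => ->; rewrite mul0r subr0 -leNgt.
  apply: le_trans hs _; rewrite -[leRHS]invrK lef_pV2 ?posrE ?invr_gt0 //.
  apply/ltW/(lt_le_trans (truncnS_gt _)); rewrite ler_nat.
  by apply: leq_trans (ltnW lt); rewrite leq_maxr.
split=> //=; rewrite -(ltr_nat R); apply: le_lt_trans (truncnS_gt _).
apply: le_trans hr _; apply: ler_wpM2l; first by rewrite addr_ge0.
by rewrite ler_nat.
Qed.

Lemma log_floor (a x : R) : 1 < a -> 1 <= x ->
  exists K, a ^+ K <= x < a ^+ K.+1.
Proof.
move=> a1 x1.
have bern k : 1 + k%:R * (a - 1) <= a ^+ k.
  elim: k => [|k IH]; first by rewrite mul0r addr0 expr0.
  rewrite exprS -natr1.
  have : a * (1 + k%:R * (a - 1)) <= a * a ^+ k by rewrite ler_pM2l //; lra.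
  have : 0 <= k%:R * (a - 1) ^+ 2 by rewrite mulr_ge0 // sqr_ge0.
  by rewrite expr2; nra.
have ex : exists k, x < a ^+ k.+1.
  exists (Num.trunc (x / (a - 1))); apply: lt_le_trans (bern _).
  have := truncnS_gt (x / (a - 1)); rewrite ltr_pdivrMr ?subr_gt0 // => h.
  by lra.
case: (ex_minnP ex) => K hK min; exists K; rewrite hK andbT.
case: K hK min => [|K] hK min; first by rewrite expr0.
by rewrite leNgt; apply/negP => /min; rewrite ltnn.
Qed.

Lemma pow6_le_exp2 (s : nat) : (32 <= s)%N -> 4 * s%:R ^+ 6 <= 2 ^+ s :> R.
Proof.
move=> h; rewrite -(subnK h); elim: (s - 32)%N => [|t IH].
  rewrite add0n; have -> : (32 : R) = 2 ^+ 5 by rewrite -natrX.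
  have -> : (4 : R) = 2 ^+ 2 by rewrite -natrX.
  by rewrite -exprM -exprD.
rewrite addSn [2 ^+ _.+1]exprS; apply: (@le_trans _ _ (2 * (4 * (t + 32)%:R ^+ 6))); last first.
  by rewrite ler_pM2l.
rewrite [leRHS]mulrCA ler_pM2l //.
have h1 : (t + 32).+1%:R <= 33 / 32 * (t + 32)%:R :> R.
  have : 0 <= t%:R :> R by [].
  by rewrite -natr1 natrD; lra.
apply: (@le_trans _ _ ((33 / 32 * (t + 32)%:R) ^+ 6)).
  by apply: lerXn2r; rewrite ?nnegrE // mulr_ge0.
rewrite exprMn; apply: ler_wpM2r; first by apply: exprn_ge0.
by lra.
Qed.

Lemma small_root (k : nat) (x d : R) : 0 < d -> x ^+ k.+1 <= d ^+ k.+1 -> x <= d.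
Proof.
move=> d0 h; rewrite leNgt; apply/negP => lt; move: h; rewrite leNgt => /negP; apply.
by apply: ltrXn2r => //; exact: ltW.
Qed.

Lemma geometric_small (a d : R) : 0 < a < 1 -> 0 < d -> exists k, a ^+ k <= d.
Proof.
case/andP=> a0 a1 d0.
have [k /andP[_ hk]] : exists k, a^-1 ^+ k <= Num.max 1 d^-1 < a^-1 ^+ k.+1.
  by apply: log_floor; rewrite ?invf_gt1 // le_max lexx.
exists k.+1; rewrite -[leRHS]invrK -[leLHS]invrK -exprVn lef_pV2 ?posrE ?invr_gt0 //.
  by apply/ltW/(le_lt_trans _ hk); rewrite le_max lexx orbT.
by rewrite exprn_gt0 // invr_gt0.
Qed.

(** K is the integer part of 6 log s / log (7/4).  The second bound holds because
    (7/8)^5 < 4/7 makes (s (7/8)^K)^5 of order at most s^5 / s^6.  In the third,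
    864/875 is (6/5)^3 / (7/4). *)
Lemma exponent_choice (d : R) : 0 < d -> exists S : nat, forall s : nat, (S <= s)%N ->
  exists K : nat, [/\ 4 <= (7 / 4 : R) ^+ K <= s%:R ^+ 6,
    2 * (s%:R * (7 / 8) ^+ K) <= d & (864 / 875) ^+ K <= d ^+ 3].
Proof.
have a0 : 0 < (7 / 4 : R) by lra.
have a1 : 1 < (7 / 4 : R) by lra.
have b01 : 0 <= (864 / 875 : R) <= 1 by lra.
have c0 : 0 <= (7 / 8 : R) by lra.
move=> d0; have d3 : 0 < d ^+ 3 by rewrite exprn_gt0.
have a01 : 0 < (864 / 875 : R) < 1 by lra.
have [K0 hK0] := geometric_small a01 d3.
pose e := d / 4; have e0 : 0 < e ^+ 5 by rewrite exprn_gt0 // divr_gt0.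
exists (maxn 7 (maxn (Num.trunc ((7 / 4 : R) ^+ K0.+1)).+1 (Num.trunc (e ^+ 5)^-1).+1)).
move=> s; rewrite !geq_max => /and3P[s7 hs1 hs2].
have s0 : (0 < s)%N by apply: leq_trans s7.
have s1 : 1 <= s%:R :> R by rewrite ler1n.
have sp : 0 < s%:R :> R by rewrite ltr0n.
have {hs1}hs1 : (7 / 4) ^+ K0.+1 <= s%:R :> R.
  by apply/ltW/(lt_le_trans (truncnS_gt _)); rewrite ler_nat.
have {hs2}hs2 : s%:R^-1 <= e ^+ 5 :> R.
  rewrite -[leRHS]invrK lef_pV2 ?posrE ?invr_gt0 //.
  by apply/ltW/(lt_le_trans (truncnS_gt _)); rewrite ler_nat.
have [K /andP[hK1 hK2]] : exists K, (7 / 4 : R) ^+ K <= s%:R ^+ 6 < (7 / 4 : R) ^+ K.+1.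
  by apply: log_floor; rewrite ?exprn_ege1.
have ss6 : s%:R <= s%:R ^+ 6 :> R by apply: ler_eXnr.
have hK4 : 4 <= (7 / 4 : R) ^+ K.
  have : 7 <= s%:R :> R by rewrite ler_nat.
  move: (le_lt_trans ss6 hK2); rewrite exprS; set y := _ ^+ K; set z := s%:R.
  by clear; lra.
suff z : 2 * (s%:R * (7 / 8) ^+ K) <= d.
  exists K; split => //; first by rewrite hK4.
  apply: le_trans hK0; case/andP: b01 => b0 b1; apply: ler_wiXn2l => //.
  have lt : (7 / 4) ^+ K0.+1 < (7 / 4 : R) ^+ K.+1.
    by apply: le_lt_trans hK2; apply: le_trans ss6.
  by move: lt; rewrite ltr_eXn2l // ltnS; exact: ltnW.
(* The exponent K + 1 loses a factor 7/8 < 1, absorbed by e = d / 4. *)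
have z : s%:R * (7 / 8) ^+ K.+1 <= e.
  apply: (@small_root 4); first by rewrite divr_gt0.
  apply: le_trans hs2; rewrite exprMn -exprM mulnC exprM.
  apply: (@le_trans _ _ (s%:R ^+ 5 * (4 / 7) ^+ K.+1)).
    by rewrite ler_pM2l ?exprn_gt0 //; apply: lerXn2r; rewrite ?nnegrE; clear; lra.
  have -> : (4 / 7 : R) = (7 / 4)^-1 by rewrite invf_div.
  rewrite exprVn ler_pdivrMr ?exprn_gt0 //.
  rewrite -ler_pdivrMl ?invr_gt0 // invrK -exprS.
  exact: ltW.
move: z; rewrite exprS /e => z.
have : 0 <= s%:R * (7 / 8) ^+ K :> R by rewrite mulr_ge0 ?exprn_ge0.
by clear -z; move: z; set y := _ ^+ K; lra.
Qed.
End Arith.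

Section Good.
Variable R : realType.

(** (1 - x/3)^3 (1 + x) <= 1 on [0, 1], applied to x = 1/p.  It converts the decay
    of the pairs with few primes into a power of the product of 1 + 1/p. *)
Lemma prod_cube_le (I : finType) (p : I -> nat) : (forall i, 0 < p i)%N ->
  (\prod_i (1 - (p i)%:R^-1 / 3)) ^+ 3 * \prod_i (1 + (p i)%:R^-1) <= 1 :> R.
Proof.
move=> p0; rewrite -prodrXl -big_split /=.
apply: (@le_trans _ _ (\prod_(i : I) 1)); last by rewrite big1.
apply: ler_prod => i _.
have : 0 <= ((p i)%:R : R)^-1 <= 1.
  by apply/andP; split; [rewrite invr_ge0|rewrite invf_le1 ?ler1n ?ltr0n].
move: (_^-1) => x /andP[x0 x1]; apply/andP; split.
  by apply: mulr_ge0; [apply: exprn_ge0; lra | lra].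
have -> : (1 - x / 3) ^+ 3 * (1 + x) =
  1 - x ^+ 2 * (2 / 3 - 8 / 27 * x + x ^+ 2 / 27) by field.
rewrite gerBl; apply: mulr_ge0; first exact: exprn_ge0.
by have : 0 <= x ^+ 2 by [exact: exprn_ge0]; lra.
Qed.

(** The data of one block, with eps bounding the measure of the union of intervals
    of length 1/N around the centres modulo 1.  With M = s, [gm_mass] is the hypothesis of [near_full_mass], and
    [gm_size] gives cofactors at most (2^(s^11))^s = 2^(s^12). *)
Record good_modulus (gamma eps : R) (Q0 : nat) (I : finType) (p : I -> nat)
    (r : int) (s : nat) : Prop := GoodModulus {
  gm_prime : forall i, prime (p i);
  gm_inj : injective p;
  gm_large : forall i, (Q0 < p i)%N;
  gm_s0 : (0 < s)%N;
  gm_approx : `|gamma - r%:~R / s%:R| < expR (- s%:R ^+ 12);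
  gm_size : forall i, (p i <= 2 ^ (s ^ 11))%N;
  gm_N4 : (4 <= fullprod p)%N;
  gm_mass : 2 * \prod_i ((p i)%:R + 1) <= 2 ^+ s * (fullprod p)%:R :> R;
  gm_residues : #|residues p r s|%:R <= eps * (fullprod p)%:R }.

Lemma good_modulus_ex (gamma eps : R) (Q0 : nat) : gamma <> 0 ->
  exp12_approximable gamma -> 0 < eps ->
  exists (I : finType) (p : I -> nat) (r : int) (s : nat),
    good_modulus gamma eps Q0 p r s.
Proof.
move=> g0 ginf e0; have d0 : 0 < eps / 2 by rewrite divr_gt0.
have [S1 hS1] := exponent_choice d0.
pose G := 4 * (`|gamma| + 1) * Q0`!%:R.
have [[r s] /=] := approximable_large (maxn (maxn 32 S1) (Num.trunc G).+1) g0 ginf.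
rewrite !gtn_max -andbA => -[/and3P[s32 sS1 sG] r0 hr hrs].
have s0 : (0 < s)%N by apply: leq_trans s32.
have {sG}sG : G <= s%:R.
  by apply/ltW/(lt_le_trans (truncnS_gt _)); rewrite ler_nat ltnW.
have [K [/andP[hK4 hK6] hKd hK3]] := hS1 s (ltnW sS1).
set T := (7 / 4) ^+ K in hK4 hK6.
(* A prime that does not divide Q0! exceeds Q0. *)
pose n := (`|r| * s * Q0`!)%N.
have n0 : (0 < n)%N by rewrite !muln_gt0 absz_gt0 r0 s0 fact_gt0.
have T1 : 1 <= T by apply: le_trans hK4; rewrite ler1n.
(* n is at most of order s^2 and T <= s^6, so s^11 leaves a spare factor s^3,
   which exceeds the implied constant G. *)
have hnT : 4 * n%:R * T <= (s ^ 11)%:R.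
  apply: (@le_trans _ _ (G * s%:R ^+ 2 * s%:R ^+ 6)).
    apply: ler_pM => //; rewrite ?mulr_ge0 ?ler0n //; first by lra.
    rewrite /n /G !natrM expr2.
    have -> : 4 * (`|r|%N%:R * s%:R * Q0`!%:R) = (4 * s%:R * Q0`!%:R) * `|r|%N%:R :> R by ring.
    have -> : 4 * (`|gamma| + 1) * Q0`!%:R * (s%:R * s%:R) =
      (4 * s%:R * Q0`!%:R) * ((`|gamma| + 1) * s%:R) by ring.
    by apply: ler_wpM2l; rewrite ?mulr_ge0.
  apply: (@le_trans _ _ (s%:R * s%:R ^+ 2 * s%:R ^+ 6)).
    by do 2![apply: ler_wpM2r; first exact: exprn_ge0].
  rewrite natrX -exprS -exprD; apply: ler_weXn2l => //; by rewrite ler1n.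
have [l [ul hl /andP[hT1 hT2]]] := primes_window n0 T1 hnT.
pose p (i : 'I_(size l)) := nth 0%N l i.
have pl i : p i \in l by rewrite mem_nth.
have pr i : prime (p i) by have [] := hl _ (pl i).
have p0 i : (0 < p i)%N by apply: prime_gt0.
have pn i : ~~ (p i %| n)%N by have [] := hl _ (pl i).
have prodE (F : nat -> R) : \prod_(x <- l) F x = \prod_i F (p i).
  by rewrite (big_nth 0%N) big_mkord.
move: hT1 hT2; rewrite prodE; set P := \prod_i _ => hT1 hT2.
have P1 : \prod_i ((p i)%:R + 1) = (fullprod p)%:R * P :> R.
  rewrite /fullprod natr_prod -big_split /=; apply: eq_bigr => i _.
  by rewrite mulrDr mulr1 mulfV // pnatr_eq0 -lt0n.
pose F : R := \prod_i (1 - (p i)%:R^-1 / 3).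
have P2 : \prod_i ((p i)%:R - 3^-1) = (fullprod p)%:R * F :> R.
  rewrite /fullprod natr_prod -big_split /=; apply: eq_bigr => i _.
  by rewrite mulrBr mulr1 mulrA mulfV ?mul1r // pnatr_eq0 -lt0n.
have N0 : 0 <= (fullprod p)%:R :> R by [].
have F3 := prod_cube_le p0; rewrite -/F -/P in F3.
have F0 : 0 <= F.
  apply: prodr_ge0 => i _.
  have : ((p i)%:R : R)^-1 <= 1 by rewrite invf_le1 ?ler1n ?ltr0n.
  by move: (_^-1) => x; lra.
have T0 : 0 < T by apply: lt_le_trans T1.
have few_primes : (6 / 5) ^+ K * F <= eps / 2.
  apply: (@small_root R 2) => //; apply: le_trans hK3.
  have -> : (864 / 875 : R) = (6 / 5) ^+ 3 * (7 / 4)^-1 by rewrite invf_div; lra.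
  rewrite exprMn [leRHS]exprMn -!exprM mulnC exprVn.
  apply: ler_wpM2l; first by apply: exprn_ge0; lra.
  rewrite -/T -[leRHS]mul1r ler_pdivlMr //.
  by apply: le_trans F3; apply: ler_wpM2l => //; apply: exprn_ge0.
have many_primes : 2 ^- K * (s%:R * P) <= eps / 2.
  apply: le_trans hKd.
  have -> : 2 * (s%:R * (7 / 8) ^+ K) = 2 ^- K * (s%:R * (2 * T)) :> R.
    have -> : (7 / 8 : R) = 2^-1 * (7 / 4) by lra.
    by rewrite exprMn exprVn -/T; ring.
  by apply: ler_wpM2l; rewrite ?invr_ge0 ?exprn_ge0 // ler_wpM2l.
exists 'I_(size l), p, r, s; split => //.
- by move=> i j /eqP; rewrite nth_uniq // => /eqP/val_inj.
- move=> i; rewrite ltnNge; apply/negP => h; move: (pn i); apply/negP; rewrite negbK.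
  by rewrite /n dvdn_mull // dvdn_fact // p0.
- by move=> i; have [] := hl _ (pl i).
- rewrite -(ler_nat R); apply: le_trans hK4 _; apply: le_trans hT1 _.
  rewrite /fullprod natr_prod; apply: ler_prod => i _.
  by rewrite addr_ge0 ?invr_ge0 //= add1_invp_le.
- rewrite P1 mulrCA mulrC; apply: ler_wpM2r => //.
  by have := pow6_le_exp2 R (ltnW s32); lra.
have pinj : injective p by move=> i j /eqP; rewrite nth_uniq // => /eqP/val_inj.
have ps i : ~~ (p i %| s)%N.
  by apply: contra (pn i) => h; rewrite /n dvdn_mulr // dvdn_mull.
have prr i : ~~ (p i %| r)%Z.
  by apply: contra (pn i) => h; rewrite /n -mulnA dvdn_mulr.
apply: le_trans (card_residues R pr pinj ps prr K) _; rewrite P1 P2.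
have -> : 2 ^- K * (s%:R * ((fullprod p)%:R * P)) + (6 / 5) ^+ K * ((fullprod p)%:R * F)
  = (2 ^- K * (s%:R * P) + (6 / 5) ^+ K * F) * (fullprod p)%:R by ring.
by apply: ler_wpM2r => //; lra.
Qed.
End Good.

(** * Measure and mass of one block *)

Section Block.
Variable R : realType.

Lemma balls_cover (xs : seq R) (rho : R) : 0 <= rho ->
  exists U : set R, [/\ measurable U,
    (lebesgue_measure U <= ((size xs)%:R * (2 * rho))%:E)%E &
    forall x alpha, x \in xs -> `|alpha - x| <= rho -> U alpha].
Proof.
move=> rho0; elim: xs => [|x xs [U [mU hU inU]]].
  by exists set0; split=> //; rewrite measure0 mul0r.
exists (`[x - rho, x + rho]%classic `|` U); split.
- exact: measurableU.
- apply: le_trans (measureU2 _ _ _) _ => //.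
  rewrite /= -natr1 addrC mulrDl mul1r EFinD; apply: leeD => //.
  rewrite lebesgue_measure_itv /= lte_fin; case: ifP => _.
    by rewrite -EFinD lee_fin; lra.
  by rewrite lee_fin; lra.
move=> y alpha; rewrite inE => /orP[/eqP ->|ys] h.
  left; rewrite /= in_itv /=; move: h; rewrite ler_distl.
  by case/andP=> h1 h2; apply/andP; split; lra.
by right; apply: inU ys h.
Qed.

Variables (gamma eps : R) (Q0 : nat) (I : finType) (p : I -> nat) (r : int) (s : nat).
Hypothesis gm : good_modulus gamma eps Q0 p r s.

Let pr := gm_prime gm.
Let pinj := gm_inj gm.
Let q := subprod p.
Let N := fullprod p.
Let N0 : 0 < N%:R :> R. Proof. by rewrite ltr0n; apply: fullprod_gt0. Qed.
Let q0 B : 0 < (q B)%:R :> R. Proof. by rewrite ltr0n; apply: subprod_gt0. Qed.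

Let family := near_full I s.

Definition block_psi (n : nat) : R :=
  if [exists B in family, n == q B] then n%:R / N%:R else 0.

Lemma block_psi_ge0 n : 0 <= block_psi n.
Proof. by rewrite /block_psi; case: ifP => // _; rewrite divr_ge0 // ltW. Qed.

Lemma block_psi_subprod B : B \in family -> block_psi (q B) = (q B)%:R / N%:R.
Proof. by move=> hB; rewrite /block_psi ifT //; apply/existsP; exists B; rewrite hB /=. Qed.

Lemma block_psi_neq0 n : block_psi n != 0 -> exists2 B, B \in family & n = q B.
Proof.
rewrite /block_psi; case: ifP => [/existsP [B /andP[hB /eqP ->]] _|_ /eqP //].
by exists B.
Qed.

Lemma subprod_gt B : B \in family -> (Q0 < q B)%N.
Proof.
rewrite in_near_full => /andP[/card_gt0P [i iB] _]; apply: (leq_trans (gm_large gm i)).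
by apply: dvdn_leq; [apply: subprod_gt0 | rewrite dvdn_subprod].
Qed.

Lemma subprod_le B : (q B <= N)%N.
Proof.
rewrite /N -(subprodC p B) leq_pmulr //; exact: subprod_gt0.
Qed.

Lemma block_sum :
  4^-1 <= \sum_(n < N.+1) block_psi n * (totient n)%:R / n%:R.
Proof.
have -> : 4^-1 = 4^-1 * N%:R / N%:R :> R by rewrite mulfK ?gt_eqF.
rewrite ler_pdivrMr //; apply: le_trans (near_full_mass pr pinj (gm_N4 gm) (gm_mass gm)) _.
rewrite mulr_suml.
have ltq B : (q B < N.+1)%N by rewrite ltnS subprod_le.
rewrite (partition_big (fun B => Ordinal (ltq B)) xpredT) //=.
apply: ler_sum => n _.
case: (pickP (fun B => (B \in family) && (Ordinal (ltq B) == n))); last first.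
  move=> h; rewrite big_pred0 // !mulr_ge0 ?block_psi_ge0 ?invr_ge0 //.
move=> B /andP[hB /eqP <-]; rewrite (big_pred1 B); last first.
  move=> B' /=; apply/andP/eqP => [[_ /eqP [] /(subprod_inj pr pinj)] // | -> //].
rewrite /= block_psi_subprod // le_eqVlt; apply/orP; left; apply/eqP; field.
by rewrite !gt_eqF.
Qed.

Lemma cofactor_le B : B \in family -> (q (~: B))%:R * expR (- s%:R ^+ 12) <= 1 :> R.
Proof.
rewrite in_near_full => /andP[_ hB]; rewrite expRN ler_pdivrMr ?expR_gt0 // mul1r.
apply: (@le_trans _ _ (2 ^+ (s ^ 12))).
  rewrite -natrX ler_nat; apply: (@leq_trans (\prod_(i in ~: B) 2 ^ (s ^ 11))%N).
    by apply: leq_prod => i _; apply: gm_size gm i.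
  rewrite prod_nat_const -expnM leq_exp2l // (expnSr s 11) leq_mul2l hB orbT //.
rewrite -[s%:R ^+ 12]natrX -[(s ^ 12)%:R]mulr1 expRM_natl; apply: lerXn2r; rewrite ?nnegrE ?expR_ge0 //.
by apply: le_trans (expR_ge1Dx _).
Qed.

(** Up to the error exp(-s^12)/q <= 1/N, the centres are residues c/(N s) shifted
    by an integer j.  As alpha and c/(N s) lie in [0, 1) and 2/N <= 1/2, only
    j = -1, 0, 1 are needed: three intervals of length 4/N for each residue. *)
Lemma block_cover : exists U : set R, [/\ measurable U,
    (lebesgue_measure U <= (12 * eps)%:E)%E &
    forall (alpha : R) (a : int) (n : nat), 0 <= alpha < 1 -> coprimez a n%:Z ->
      block_psi n != 0 ->
      `|alpha - (a%:~R + gamma) / n%:R| <= block_psi n / n%:R -> U alpha].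
Proof.
pose xs : seq R := [seq j%:~R + (c : 'I_(N * s))%:R / (N * s)%:R
   | c <- enum (residues p r s), j <- [:: -1; 0; 1 : int]].
have rho0 : 0 <= 2 / N%:R :> R by rewrite divr_ge0 // ltW.
have [U [mU hU inU]] := balls_cover xs rho0; exists U; split => //.
  apply: le_trans hU _; rewrite lee_fin size_allpairs /= -cardE natrM.
  have := gm_residues gm; rewrite -/N.
  rewrite -ler_pdivrMr // => h.
  have -> : #|residues p r s|%:R * 3 * (2 * (2 / N%:R)) =
    12 * (#|residues p r s|%:R / N%:R) :> R by ring.
  by rewrite ler_pM2l.
move=> alpha a n al cop /block_psi_neq0 [B hB] nB; rewrite nB in cop *.
rewrite block_psi_subprod // => h.
have s0 : 0 < s%:R :> R by rewrite ltr0n; apply: gm_s0 gm.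
have Ns0 : (0 < N * s)%N by rewrite muln_gt0 (gm_s0 gm) andbT; apply: fullprod_gt0.
have Nsz : (N * s)%N%:Z != 0 by rewrite eqz_nat -lt0n.
have NqE : N%:R = (q B)%:R * (q (~: B))%:R :> R by rewrite -natrM; congr _%:R; rewrite /q subprodC.
set m := numer p r s B a.
pose c := (m %% (N * s)%N%:Z)%Z; pose j := (m %/ (N * s)%N%:Z)%Z.
have zE : (a%:~R + r%:~R / s%:R) / (q B)%:R = m%:~R / (N * s)%:R :> R.
  rewrite /m /numer rmorphM /= rmorphD rmorphM /= natrM NqE -!pmulrn.
  by field; rewrite !gt_eqF.
(* 1/N for the radius and 1/N for replacing gamma by r/s. *)
have near : `|alpha - m%:~R / (N * s)%:R| <= 2 / N%:R.
  rewrite -zE.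
  have -> : alpha - (a%:~R + r%:~R / s%:R) / (q B)%:R =
    (alpha - (a%:~R + gamma) / (q B)%:R) + (gamma - r%:~R / s%:R) / (q B)%:R by ring.
  apply: le_trans (ler_normD _ _) _.
  have -> : 2 / N%:R = 1 / N%:R + 1 / N%:R :> R by ring.
  apply: lerD.
    apply: le_trans h _; rewrite mulrAC mulfV ?gt_eqF //.
  rewrite normrM normfV (gtr0_norm (q0 B)) ler_pdivrMr // mulrAC.
  apply: le_trans (ltW (gm_approx gm)) _.
  rewrite ler_pdivlMr // mul1r NqE mulrCA -[leRHS]mulr1 ler_pM2l // mulrC.
  exact: cofactor_le.
have cge : 0 <= c by apply: modz_ge0.
have clt : c < (N * s)%N%:Z by apply: ltz_pmod.
have mE : m%:~R / (N * s)%:R = j%:~R + c%:~R / (N * s)%:R :> R.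
  rewrite [in LHS](divz_eq m (N * s)%N%:Z) -/c -/j rmorphD rmorphM /= -pmulrn.
  by rewrite mulrDl mulfK // pnatr_eq0 -lt0n.
have ltc : (`|c| < N * s)%N by rewrite -ltz_nat gez0_abs.
have cE : `|c|%N%:R = c%:~R :> R by rewrite pmulrn gez0_abs.
apply: (inU (j%:~R + `|c|%N%:R / (N * s)%:R)); last by rewrite cE -mE.
apply/allpairsP; exists (Ordinal ltc, j); split => //=.
  rewrite mem_enum inE; apply/existsP; exists B.
  have qz : (q B)%:Z != 0 by rewrite eqz_nat -lt0n; apply: subprod_gt0.
  have age : 0 <= (a %% (q B)%:Z)%Z by apply: modz_ge0.
  have alt : (`|(a %% (q B)%:Z)%Z| < q B)%N.
    by rewrite -ltz_nat gez0_abs // ltz_pmod // ltz_nat; apply: subprod_gt0.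
  (* a enters only through its residue modulo q. *)
  have cop' : coprime `|(a %% (q B)%:Z)%Z| (q B).
    by move: cop; rewrite /coprimez -gcdz_modl /gcdz absz_nat eqz_nat.
  apply/existsP; exists (Ordinal alt) => /=; rewrite cop' !gez0_abs //=.
  rewrite /c /m /numer {2}(divz_eq a (q B)%:Z) -/N.
  have -> : (((a %/ q B)%Z * q B + (a %% q B)%Z) * s + r) * subprod p (~: B)
    = (a %/ q B)%Z * (N * s)%N%:Z + ((a %% q B)%Z * s + r) * subprod p (~: B).
    by rewrite -/(q _) PoszM /N -(subprodC p B) PoszM -/(q _); ring.
  by rewrite modzMDl.
have cR : 0 <= (c%:~R : R) / (N * s)%:R < 1.
  rewrite divr_ge0 ?ler0z //= ltr_pdivrMr ?ltr0n // mul1r [X in _ < X]pmulrn ltr_int //.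
have N4 : 2 / N%:R <= 2^-1 :> R.
  by rewrite ler_pdivrMr //; have : 4 <= N%:R :> R by [rewrite ler_nat; apply: gm_N4 gm]; lra.
move: near; rewrite mE ler_norml => /andP[n1 n2].
have j1 : j < 2.
  by rewrite -(ltr_int R); case/andP: al cR => ? ? /andP[? ?]; lra.
have j2 : -2 < j.
  by rewrite -(ltr_int R); case/andP: al cR => ? ? /andP[? ?]; lra.
clear -j1 j2; rewrite !inE; lia.
Qed.
End Block.

(** * Gluing the blocks *)

Section Glue.
Variable R : realType.
Variable gamma : R.

(** What the gluing needs of a block: support in ]Q0, Q1], mass at least 1/4, and a
    measurable set of small measure containing its part of the limsup set. *)
Record good_block (eps : R) (Q0 : nat) (Q1 : nat) (psi : nat -> R) (U : set R)
    : Prop := GoodBlock {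
  gb_lt : (Q0 < Q1)%N;
  gb_ge0 : forall q, 0 <= psi q;
  gb_supp : forall q, psi q != 0 -> (Q0 < q <= Q1)%N;
  gb_sum : 4^-1 <= \sum_(0 <= q < Q1.+1) psi q * (totient q)%:R / q%:R;
  gb_meas : measurable U;
  gb_small : (lebesgue_measure U <= eps%:E)%E;
  gb_cover : forall (alpha : R) (a : int) (q : nat), 0 <= alpha < 1 ->
      coprimez a q%:Z -> psi q != 0 ->
      `|alpha - (a%:~R + gamma) / q%:R| <= psi q / q%:R -> U alpha }.

Lemma good_block_ex (eps : R) (Q0 : nat) : gamma <> 0 -> exp12_approximable gamma ->
  0 < eps -> exists Q1 psi U, good_block eps Q0 Q1 psi U.
Proof.
move=> g0 ginf e0; have e12 : 0 < eps / 12 by rewrite divr_gt0.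
have [I [p [r [s gm]]]] := good_modulus_ex Q0 g0 ginf e12.
have [U [mU hU covU]] := block_cover gm.
exists (fullprod p), (block_psi R p s), U; split => //.
- have N4 := gm_N4 gm.
  case: (pickP (xpredT : pred I)) => [i _|h]; last first.
    by move: N4; rewrite /fullprod big_pred0.
  apply: (leq_trans (gm_large gm i)); apply: dvdn_leq.
    exact: fullprod_gt0 (gm_prime gm).
  by rewrite /fullprod (bigD1 i) //= dvdn_mulr.
- by move=> q; exact: block_psi_ge0.
- move=> q /block_psi_neq0 [B hB ->]; rewrite (subprod_gt gm hB) /=.
  exact: subprod_le gm B.
- by rewrite big_mkord; apply: block_sum gm.
- by apply: le_trans hU _; rewrite lee_fin; lra.
Qed.

End Glue.

Section Limsup.
Variable R : realType.

(** For fixed alpha, an infinite set of approximations has unbounded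
    denominators. *)
Lemma finite_approximants (gamma alpha : R) (psi : nat -> R) (Q : nat) :
  (forall q, 0 <= psi q) ->
  finite_set [set aq : int * nat | [/\ (0 < aq.2 <= Q)%N &
        `|alpha - (aq.1%:~R + gamma) / aq.2%:R| <= psi aq.2 / aq.2%:R]].
Proof.
move=> psi0; pose C := Q%:R * `|alpha| + `|gamma| + \sum_(q < Q.+1) psi q.
apply: (@finite_bounded_pairs _ (Num.trunc C).+1 Q) => -[a q] /= [/andP[q0 qQ] h].
split => //; rewrite -(ltr_nat R); apply: le_lt_trans (truncnS_gt _).
have qp : 0 < q%:R :> R by rewrite ltr0n.
have -> : `|a|%N%:R = `|a%:~R : R| by rewrite -intr_norm -abszE.
have -> : a%:~R = q%:R * alpha - gamma - q%:R * (alpha - (a%:~R + gamma) / q%:R) :> R.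
  by field; rewrite gt_eqF.
apply: le_trans (ler_normB _ _) _; rewrite /C; apply: lerD.
  apply: le_trans (ler_normB _ _) _; rewrite lerD2r normrM (gtr0_norm qp).
  by apply: ler_wpM2r; rewrite // ler_nat.
rewrite normrM (gtr0_norm qp) mulrC -ler_pdivlMr //; apply: le_trans h _.
apply: ler_wpM2r; first by rewrite invr_ge0 ltW.
have lt : (q < Q.+1)%N by [].
by rewrite (bigD1 (Ordinal lt)) //= lerDl sumr_ge0.
Qed.

(** The Lebesgue measure is the restriction of an outer measure defined on every
    set, so monotonicity does not require measurability. *)
Lemma le_lebesgue_measure (A B : set R) :
  A `<=` B -> (lebesgue_measure A <= lebesgue_measure B)%E.
Proof.
rewrite /lebesgue_measure /lebesgue_stieltjes_measure /measure_extension.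
by move=> AB; apply le_mu_ext.
Qed.

Lemma countable_centers (gamma : R) :
  countable (range (fun aq : int * nat => (aq.1%:~R + gamma) / aq.2%:R)).
Proof. by apply: sub_countable (card_image_le _ _) _; exact: countableP. Qed.
End Limsup.

Theorem theorem1 (R : realType) (gamma : R) (gamma_neq0 : gamma <> 0)
    (gammaP : exp12_approximable gamma) :
  exists psi : nat -> R,
    [/\ forall q : nat, (0 < q)%N -> 0 <= psi q,
        (\sum_(1 <= q <oo) (psi q * (totient q)%:R / q%:R)%:E = +oo)%E &
        lebesgue_measure (W' psi gamma) = 0%E].
Proof.
have /choice [f fP] : forall nQ : nat * nat, exists x : nat * (nat -> R) * set R,
    good_block gamma (1 / (2 ^ nQ.1.+1)%:R) nQ.2 x.1.1 x.1.2 x.2.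
  move=> [n Q].
  have e0 : 0 < 1 / (2 ^ n.+1)%:R :> R by rewrite divr_gt0 // ltr0n expn_gt0.
  have [Q1 [psi [U h]]] := good_block_ex Q gamma_neq0 gammaP e0.
  by exists (Q1, psi, U).
pose Q := fix Q n := if n is n'.+1 then (f (n', Q n')).1.1 else 0%N.
pose psi_ n := (f (n, Q n)).1.2; pose U n := (f (n, Q n)).2.
have blk n : good_block gamma (1 / (2 ^ n.+1)%:R) (Q n) (Q n.+1) (psi_ n) (U n).
  exact: fP (n, Q n).
have Qlt n : (Q n < Q n.+1)%N := gb_lt (blk n).
have Qmono m n : (m <= n)%N -> (Q m <= Q n)%N.
  elim: n => [|n IH]; first by rewrite leqn0 => /eqP ->.
  by rewrite leq_eqVlt ltnS => /predU1P[-> // | /IH h]; apply: leq_trans h (ltnW (Qlt n)).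
have Qge n : (n <= Q n)%N by elim: n => // n IH; apply: leq_ltn_trans IH (Qlt n).
have supp n q : psi_ n q != 0 -> (Q n < q <= Q n.+1)%N by apply: (gb_supp (blk n) (q := q)).
(* At most one term is nonzero, and Q n >= n makes it occur among the n < q. *)
pose psi q := \sum_(0 <= n < q) psi_ n q.
have psi_0 n q : 0 <= psi_ n q := gb_ge0 (blk n) q.
have psi0 q : 0 <= psi q by apply: sumr_ge0.
have psi_le M q : \sum_(0 <= n < M) psi_ n q <= psi q.
  have [Mq|qM] := leqP M q.
    by rewrite /psi (@big_cat_nat _ _ _ M _ q) //= lerDl sumr_ge0.
  rewrite (@big_cat_nat _ _ _ q _ M) //=; last exact: ltnW.
  have -> : \sum_(q <= n < M) psi_ n q = 0; last by rewrite addr0.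
  rewrite big_nat_cond big1 // => n /andP[/andP[qn _] _].
  apply/eqP; apply: contraT => /supp /andP[+ _].
  by rewrite ltnNge (leq_trans qn (Qge n)).
have psiE m q : psi_ m q != 0 -> psi q = psi_ m q.
  move=> hm; have /andP[mq qm] := supp _ _ hm.
  have ltm : (m < q)%N by apply: leq_ltn_trans (Qge m) mq.
  rewrite /psi big_mkord (bigD1 (Ordinal ltm)) //= big1 ?addr0 // => n.
  rewrite -val_eqE /= => nm; apply/eqP; apply: contraT => /supp /andP[h1 h2].
  case: ltngtP nm => // nm _.
    by have := leq_trans h2 (Qmono _ _ nm); rewrite leqNgt mq.
  by have := leq_trans qm (Qmono _ _ nm); rewrite leqNgt h1.
exists psi; split => [q _ | |]; first exact: psi0.
- have term0 q : 0 <= psi q * (totient q)%:R / q%:R :> R.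
    by rewrite divr_ge0 // mulr_ge0.
  have partial n : n%:R / 4 <= \sum_(0 <= q < (Q n).+1) psi q * (totient q)%:R / q%:R.
    apply: (@le_trans _ _ (\sum_(0 <= q < (Q n).+1)
      \sum_(0 <= m < n) psi_ m q * (totient q)%:R / q%:R)); last first.
      apply: ler_sum => q _; rewrite -mulr_suml -mulr_suml.
      by do 2![apply: ler_wpM2r; rewrite ?invr_ge0 //].
    rewrite exchange_big /=; apply: (@le_trans _ _ (\sum_(0 <= m < n) 4^-1)).
      by rewrite big_const_nat subn0 iter_addr_0 -[leRHS]mulr_natl.
    apply: ler_sum_nat => m /andP[_ mn].
    apply: le_trans (gb_sum (blk m)) _.
    have Qmn : ((Q m.+1).+1 <= (Q n).+1)%N by rewrite ltnS; apply: Qmono.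
    rewrite [leRHS](big_cat_nat (leq0n _) Qmn) /=.
    by rewrite lerDl sumr_ge0 // => q _; rewrite divr_ge0 // mulr_ge0.
  apply/eqyP => A A0.
  have [n hn] : exists n : nat, A <= n%:R / 4.
    exists (Num.trunc (A * 4)).+1; rewrite ler_pdivlMr //.
    by apply/ltW/truncnS_gt.
  apply: le_trans (nneseries_lim_ge (Q n).+1 _); last first.
    by move=> q _ _; rewrite lee_fin.
  rewrite sumEFin lee_fin; apply: le_trans hn (le_trans (partial n) _).
  by rewrite big_nat_recl // invr0 mulr0 add0r big_add1.
(* Where psi vanishes the intervals reduce to their centres, which form a null
   set. *)
pose Z := range (fun aq : int * nat => (aq.1%:~R + gamma) / aq.2%:R).
have mU n : measurable (U n) := gb_meas (blk n).
have cZ : countable Z := countable_centers gamma.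
have mZ : measurable Z by apply: countable_measurable cZ; exact: measurable_set1.
have limU : lebesgue_measure (lim_sup_set U) = 0%E.
  apply: lim_sup_set_cvg0 => //.
  apply: (@le_lt_trans _ _ 1%:E); last exact: ltry.
  apply: le_trans (@epsilon_trick0 R 1 xpredT ler01).
  by apply: lee_nneseries => // n _; apply: gb_small (blk n).
apply/eqP; rewrite eq_le measure_ge0 andbT.
have sub : W' psi gamma `<=` Z `|` lim_sup_set U.
  move=> alpha [al inf]; case: (pselect (Z alpha)) => [|nZ]; first by left.
  right=> n _.
  (* Some approximation has q > Q n; as alpha is not a centre, psi q is positive,
     so q belongs to a block of index at least n. *)
  apply: contrapT => hno; apply: inf.
  apply: sub_finite_set (finite_approximants gamma alpha (Q n) psi0).
  move=> [a q] /= [q0 cop h]; split => //; rewrite q0 /= leqNgt; apply/negP => nq.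
  apply: hno.
  have pq : psi q != 0.
    apply/eqP => pq; apply: nZ; exists (a, q) => //=.
    by move: h; rewrite pq mul0r normr_le0 subr_eq0 => /eqP.
  have [m hm] : exists m, psi_ m q != 0.
    apply: contrapT => nm; move/eqP: pq; apply; apply: big1 => m _.
    by apply/eqP; apply: contrapT => /negP hm; apply: nm; exists m.
  exists m => /=.
    rewrite leqNgt; apply/negP => mn; have /andP[_ h2] := supp _ _ hm.
    by have := leq_trans h2 (Qmono _ _ mn); rewrite leqNgt nq.
  by rewrite (psiE m) // in h; apply: gb_cover (blk m) alpha a q al cop hm h.
apply: le_trans (le_lebesgue_measure sub) _.
have mL : measurable (lim_sup_set U).
  by apply: bigcap_measurableType => k _; apply: bigcup_measurable.
apply: le_trans (measureU2 lebesgue_measure mZ mL) _.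
have Z0 := countable_lebesgue_measure0 cZ.
by move: Z0 limU => /= -> ->; rewrite adde0.
Qed.
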